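(* Let $N\ge 2$ and $0<q<1$. Let $V=V(\omega_1)$ be the fundamental module of $U_q(\mathfrak{sl}_N)$ and $V^*$ its dual. Then there are no non-trivial PBW-deformations of quadratic-constant type of the braided exterior algebras $\Lambda_q(V)$ and $\Lambda_q(V^* )$. That is, for $W\in\{V,V^*\}$, if $\beta:S_q^2W\to\mathbb{C}$ is a linear map such that $T(W)/\langle x-\beta(x):x\in S_q^2W\rangle$ is a PBW-deformation of $\Lambda_q(W)=T(W)/\langle S_q^2W\rangle$, then $\beta=0$.
   Context: $q^{1/N}$ is the positive $N$-th root; $\theta(n)=1$ for $n>0$ and $\theta(n)=0$ for $n\le 0$. $V$ has basis $v_1,\dots,v_N$ and $V^*$ has dual basis $w_1,\dots,w_N$. The braidings are $$\widehat{R}_{V,V}(v_i\otimes v_j)=q^{\delta_{ij}-\frac1N}v_j\otimes v_i+\theta(j-i)q^{-\frac1N}(q-q^{-1})v_i\otimes v_j,$$ $$\widehat{R}_{V^*,V^*}(w_i\otimes w_j)=q^{\delta_{ij}-\frac1N}w_j\otimes w_i+\theta(i-j)q^{-\frac1N}(q-q^{-1})w_i\otimes w_j.$$ For $W=V$ or $V^*$, $S_q^2W\subset W\otimes W$ is the span of all eigenvectors of $\widehat{R}_{W,W}$ with positive eigenvalues, and $\Lambda_q(W)=T(W)/\langle S_q^2W\rangle$. PBW-deformations of quadratic-constant type: let $A=T(W)/\langle R\rangle$ with $R\subset W\otimes W$, and for a linear map $\beta:R\to\mathbb{C}$ let $U_\beta=T(W)/\langle x-\beta(x):x\in R\rangle$,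 filtered by degree. $U_\beta$ is a PBW-deformation of $A$ if the natural surjection $A\to\mathrm{gr}\,U_\beta$ is an isomorphism. It is trivial if $\beta=0$. *)

(* Defs.v *)
From HB Require Import structures.
From mathcomp Require Import all_boot all_order all_algebra.
From mathcomp Require Import generic_quotient ring_quotient.
From mathcomp Require Import boolp classical_sets reals exp.
From mathcomp Require Import complex.
From mathcomp Require Import finmap monalg.

Set Implicit Arguments.
Unset Strict Implicit.
Unset Printing Implicit Defensive.

Import Order.TTheory GRing.Theory Num.Theory.

Local Open Scope ring_scope.
Local Open Scope classical_set_scope.
Local Open Scope quotient_scope.
Local Open Scope complex_scope.

(** * Subspaces, ideals, subquotients *)

Section Span.
Variables (K : pzRingType) (V : lmodType K).

Definition subspace (A : set V) : Prop :=
  A 0 /\ forall (a : K) u v, A u -> A v -> A (a *: u + v).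

Definition lspan (G : set V) : {pred V} :=
  fun x => `[< smallest subspace G x >].

Lemma lspan_submod_closed G : submod_closed (lspan G).
Proof.
split; first by apply/asboolP => A [[A0 _] _].
move=> a u v /asboolP hu /asboolP hv; apply/asboolP => A hA.
by case: (hA) => -[_ Al] _; apply: Al; [apply: hu|apply: hv].
Qed.

HB.instance Definition _ G :=
  GRing.isSubmodClosed.Build K V (lspan G) (lspan_submod_closed G).

End Span.

Section SubType.

Record subsp (V : choiceType) (S : {pred V}) :=
  SubSp { subsp_val : V; _ : subsp_val \in S }.

HB.instance Definition _ (V : choiceType) (S : {pred V}) :=
  [isSub for @subsp_val V S].
HB.instance Definition _ (V : choiceType) (S : {pred V}) :=
  [Choice of subsp S by <:].
HB.instance Definition _ (K : pzRingType) (V : lmodType K)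
    (S : submodClosed V) :=
  [SubChoice_isSubLmodule of subsp S by <:].

End SubType.

Section Quotient.
Variables (K : pzRingType) (V : lmodType K) (S : submodClosed V).

(* [Quotient.quot] wants a [zmodClosed] predicate, and [submodClosed] does not
   record closure under opposite. *)
Definition zpred : {pred V} := S.

Lemma zpred_zmod_closed : zmod_closed zpred.
Proof.
split; first exact: (rpred0 S).
move=> x y hx hy; rewrite -scaleN1r.
by apply: (@rpredD _ S) => //; apply: (@rpredZ _ _ S).
Qed.

HB.instance Definition _ := GRing.isZmodClosed.Build V zpred zpred_zmod_closed.

Definition quotm : Type := Quotient.quot zpred.
HB.instance Definition _ := GRing.Zmodule.on quotm.

Definition quotm_pi (x : V) : quotm := \pi_(Quotient.quot zpred) x.
Definition quotm_repr (x : quotm) : V := repr (x : Quotient.quot zpred).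

Lemma quotm_reprK : cancel quotm_repr quotm_pi.
Proof. exact: reprK. Qed.

Lemma quotm_piE x y : (quotm_pi x == quotm_pi y) = (x - y \in S).
Proof. by rewrite /quotm_pi -Quotient.idealrBE. Qed.

Lemma quotm_pi_eq0 x : (quotm_pi x == 0) = (x \in S).
Proof.
have -> : 0 = quotm_pi 0 :> quotm.
  by symmetry; exact: (raddf0 \pi_(Quotient.quot zpred)).
by rewrite quotm_piE subr0.
Qed.

Lemma quotm_repr_pi x : x - quotm_repr (quotm_pi x) \in S.
Proof. by rewrite -quotm_piE quotm_reprK. Qed.

Lemma quotm_piB : {morph quotm_pi : x y / x - y}.
Proof. by move=> x y; exact: (raddfB \pi_(Quotient.quot zpred)). Qed.

Lemma quotm_piD : {morph quotm_pi : x y / x + y}.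
Proof. by move=> x y; exact: (raddfD \pi_(Quotient.quot zpred)). Qed.

Definition quotm_scale (a : K) (x : quotm) : quotm :=
  quotm_pi (a *: quotm_repr x).

Lemma quotm_piZ a x : quotm_scale a (quotm_pi x) = quotm_pi (a *: x).
Proof.
by apply/eqP; rewrite eq_sym quotm_piE -scalerBr rpredZ ?quotm_repr_pi.
Qed.

Lemma quotm_scaleA a b x :
  quotm_scale a (quotm_scale b x) = quotm_scale (a * b) x.
Proof. by rewrite -[x]quotm_reprK !quotm_piZ scalerA. Qed.

Lemma quotm_scale1 : left_id 1 quotm_scale.
Proof. by move=> x; rewrite -[x]quotm_reprK quotm_piZ scale1r. Qed.

Lemma quotm_scaleDr : right_distributive quotm_scale +%R.
Proof.
move=> a x y; rewrite -[x]quotm_reprK -[y]quotm_reprK.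
by rewrite -quotm_piD !quotm_piZ scalerDr quotm_piD.
Qed.

Lemma quotm_scaleDl x : {morph quotm_scale^~ x : a b / a + b}.
Proof.
by move=> a b; rewrite -[x]quotm_reprK !quotm_piZ scalerDl quotm_piD.
Qed.

HB.instance Definition _ := GRing.Zmodule_isLmodule.Build K quotm
  quotm_scaleA quotm_scale1 quotm_scaleDr quotm_scaleDl.

Lemma quotm_pi_linear : linear quotm_pi.
Proof. by move=> a x y; rewrite quotm_piD -quotm_piZ. Qed.

HB.instance Definition _ := GRing.isLinear.Build K V quotm _ quotm_pi
  quotm_pi_linear.

End Quotient.

(* [subquot A B] is A / (A `&` B); it is only used when B is contained in A. *)
Section SubQuotient.
Variables (K : pzRingType) (V : lmodType K) (A B : submodClosed V).

Definition subquot_ker : {pred subsp A} := fun x => val x \in B.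

Lemma subquot_ker_submod_closed : submod_closed subquot_ker.
Proof.
split; first exact: rpred0.
by move=> a x y hx hy; rewrite /subquot_ker unfold_in /= rpredD ?rpredZ.
Qed.

HB.instance Definition _ :=
  GRing.isSubmodClosed.Build K (subsp A) subquot_ker subquot_ker_submod_closed.

Definition subquot : lmodType K := quotm subquot_ker.

End SubQuotient.

Section Ideal.
Variables (K : pzRingType) (T : lalgType K).

Definition two_sided_ideal (I : set T) : Prop :=
  [/\ I 0, forall x y, I x -> I y -> I (x + y)
    & forall a x b, I x -> I (a * x * b)].

Definition ideal (G : set T) : {pred T} :=
  fun x => `[< smallest two_sided_ideal G x >].

Lemma ideal_submod_closed G : submod_closed (ideal G).
Proof.
split; first by apply/asboolP => A [[A0 _ _] _].
move=> a x y /asboolP hx /asboolP hy; apply/asboolP => A hA.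
case: (hA) => -[_ AD AM] _; apply: AD; last exact: hy.
by have := AM (a%:A) x 1 (hx A hA); rewrite mulr1 mulr_algl.
Qed.

HB.instance Definition _ G :=
  GRing.isSubmodClosed.Build K T (ideal G) (ideal_submod_closed G).

Lemma ideal_is_ideal G : two_sided_ideal [set x | x \in ideal G].
Proof.
split => [|x y|a x b] /=; [exact: rpred0|exact: rpredD|].
move=> /asboolP hx; apply/asboolP => A hA.
by case: (hA) => -[_ _ AM] _; apply: AM; apply: hx.
Qed.

Lemma ideal_gen G x : G x -> x \in ideal G.
Proof. by move=> Gx; apply/asboolP; apply: sub_gen_smallest. Qed.

Lemma ideal_ind G (P : set T) :
  two_sided_ideal P -> G `<=` P -> forall x, x \in ideal G -> P x.
Proof. by move=> hP GP x /asboolP; apply: smallest_sub. Qed.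

End Ideal.

(** * Quadratic algebras and their deformations *)

(* [W] is given by its basis indexed by ['I_n]: [T(W)] is the free algebra on
   ['I_n], with words as monomials, and [W ⊗ W] is ['M_n], the matrix unit
   [delta_mx i j] standing for the tensor product of basis vectors [i], [j]. *)
Notation tensor_alg K n := {malg K[fmonom 'I_n]}.

Section TensorAlgebra.
Variables (K : fieldType) (n : nat).
Local Notation T := (tensor_alg K n).

Definition generator (i : 'I_n) : T := << fmu i >>.

Definition tensor2 (x : 'M[K]_n) : T :=
  \sum_(i < n) \sum_(j < n) x i j *: (generator i * generator j).

Definition hcomp (d : nat) (t : T) : T :=
  [malg w in msupp t => if fdeg w == d then t@_w else 0].

(* The tensors of degree strictly less than [d]. *)
Definition deg_lt (d : nat) : {pred T} :=
  fun t => all (fun w => (fdeg w < d)%N) (msupp t).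

Lemma hcompE d t w : (hcomp d t)@_w = if fdeg w == d then t@_w else 0.
Proof.
rewrite mcoeffE; case: ifP => // wt; case: ifP => // _.
by rewrite mcoeff_outdom ?wt.
Qed.

Lemma deg_ltP d t :
  reflect (forall w, (d <= fdeg w)%N -> t@_w = 0) (t \in deg_lt d).
Proof.
apply: (iffP allP) => [h w dw|h w wt].
  by apply: mcoeff_outdom; apply/negP => /h; rewrite ltnNge dw.
by rewrite ltnNge; apply/negP => /h/eqP; rewrite mcoeff_eq0 wt.
Qed.

Lemma deg_lt_submod_closed d : submod_closed (deg_lt d).
Proof.
split; first by apply/deg_ltP => w _; rewrite mcoeff0.
move=> a x y /deg_ltP hx /deg_ltP hy; apply/deg_ltP => w dw.
by rewrite mcoeffD mcoeffZ hx // hy // mulr0 addr0.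
Qed.

HB.instance Definition _ d := GRing.isSubmodClosed.Build K T
  (deg_lt d) (deg_lt_submod_closed d).

Lemma hcomp_deg_lt d t : hcomp d t \in deg_lt d.+1.
Proof.
by apply/deg_ltP => w dw; rewrite hcompE; case: eqP dw => // ->; rewrite ltnn.
Qed.

Lemma hcomp_linear d : linear (hcomp d).
Proof.
move=> a x y; apply/malgP => w.
rewrite mcoeffD mcoeffZ !hcompE mcoeffD mcoeffZ.
by case: ifP => // _; rewrite mulr0 addr0.
Qed.

HB.instance Definition _ d :=
  GRing.isLinear.Build K T T _ (hcomp d) (hcomp_linear d).

Lemma hcompU d c w :
  hcomp d << c *g w >> = if fdeg w == d then << c *g w >> else 0.
Proof.
apply/malgP => k; rewrite hcompE mcoeffU; case: (eqVneq w k) => [->|wk].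
  by case: ifP => _; rewrite ?mcoeffU ?eqxx ?mcoeff0.
by rewrite mulr0n if_same; case: ifP => _; rewrite ?mcoeffU ?(negbTE wk) ?mcoeff0.
Qed.

Lemma hcompM d a u (x : T) b v :
  hcomp d (<< a *g u >> * x * << b *g v >>) =
  if (fdeg u + fdeg v <= d)%N
  then << a *g u >> * hcomp (d - (fdeg u + fdeg v)) x * << b *g v >> else 0.
Proof.
rewrite [in LHS](monalgE x) mulr_sumr mulr_suml raddf_sum /=.
case: ifP => le_d; last first.
  rewrite big1 // => w _; rewrite !malgM_def !fgmulUU hcompU !fdegM.
  by case: eqP => // def_d; move: le_d; rewrite -def_d addnAC leq_addr.
rewrite [in RHS](monalgE x) raddf_sum mulr_sumr mulr_suml /=.
apply: eq_bigr => w _; rewrite !malgM_def !fgmulUU !hcompU !fdegM.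
have -> : (fdeg u + fdeg w + fdeg v == d)%N =
          (fdeg w == d - (fdeg u + fdeg v))%N.
  by rewrite addnAC -{1}(subnKC le_d) eqn_add2l.
by case: ifP => _; rewrite -!malgM_def ?mulr0 ?mul0r // !malgM_def !fgmulUU.
Qed.

Lemma deg_ltM d a u x b v : x \in deg_lt (d - (fdeg u + fdeg v)) ->
  (fdeg u + fdeg v <= d)%N -> << a *g u >> * x * << b *g v >> \in deg_lt d.
Proof.
move=> /allP hx le_d; apply/allP => k.
case/msuppM_le => [k1 [k2 [/msuppM_le[k3 [k4 [+ hk4 ->]]] + ->]]].
move=> /(fsubsetP msuppU_le); rewrite in_fset1 => /eqP ->.
move=> /(fsubsetP msuppU_le); rewrite in_fset1 => /eqP ->.
by rewrite !fdegM addnAC -ltn_subRL hx.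
Qed.

Lemma hcomp_tensor2 d x :
  hcomp d (tensor2 x) = if d == 2%N then tensor2 x else 0.
Proof.
rewrite /tensor2 raddf_sum; case: ifP => [/eqP ->|d2].
  apply: eq_bigr => i _; rewrite raddf_sum; apply: eq_bigr => j _ /=.
  by rewrite linearZ /= malgM_def fgmulUU hcompU fdegM !fdegU.
rewrite big1 // => i _; rewrite raddf_sum big1 // => j _ /=.
by rewrite linearZ /= malgM_def fgmulUU hcompU fdegM !fdegU eq_sym d2 scaler0.
Qed.

End TensorAlgebra.

Section Deformation.
Variables (K : fieldType) (n : nat) (S : submodClosed 'M[K]_n).
Local Notation T := (tensor_alg K n).

Definition quad_ideal : {pred T} := ideal [set tensor2 (val x) | x in [set: subsp S]].
HB.instance Definition _ := GRing.SubmodClosed.on quad_ideal.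

Definition quad_alg : lmodType K := quotm quad_ideal.

Section WithBeta.
Variable beta : {linear subsp S -> K^o}.

Definition deformed_ideal : {pred T} :=
  ideal [set tensor2 (val x) - (beta x : K)%:MP | x in [set: subsp S]].
HB.instance Definition _ := GRing.SubmodClosed.on deformed_ideal.

Definition deformed_alg : lmodType K := quotm deformed_ideal.

(* The image of the tensors of degree < d, i.e. F_(d-1), with F_(-1) = 0. *)
Definition deformed_fil (d : nat) : {pred deformed_alg} := fun u =>
  `[< exists2 t, t \in deg_lt d & u = quotm_pi deformed_ideal t >].

Lemma deformed_fil_submod_closed d : submod_closed (deformed_fil d).
Proof.
split; first by apply/asboolP; exists 0; rewrite ?rpred0 ?raddf0.
move=> a x y /asboolP[t ht ->] /asboolP[s hs ->]; apply/asboolP.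
by exists (a *: t + s); rewrite ?rpredD ?rpredZ // linearP.
Qed.

HB.instance Definition _ d := GRing.isSubmodClosed.Build K deformed_alg
  (deformed_fil d) (deformed_fil_submod_closed d).

(* F_d / F_(d-1) *)
Definition gr_piece (d : nat) : lmodType K :=
  subquot (deformed_fil d.+1) (deformed_fil d).

(* The direct sum of the F_d / F_(d-1). *)
Record gr_deformed : Type := GrDeformed {
  gr_comp : forall d, gr_piece d;
  gr_finite : exists m, forall d, (m <= d)%N -> gr_comp d = 0 }.

Lemma gr_class_subproof d t :
  quotm_pi deformed_ideal (hcomp d t) \in deformed_fil d.+1.
Proof. by apply/asboolP; exists (hcomp d t); rewrite ?hcomp_deg_lt. Qed.

Definition gr_class (d : nat) (t : T) : gr_piece d :=
  quotm_pi _ (SubSp (gr_class_subproof d t)).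

Lemma gr_class_eq0 d t :
  (gr_class d t == 0) = (quotm_pi deformed_ideal (hcomp d t) \in deformed_fil d).
Proof. by rewrite quotm_pi_eq0. Qed.

Lemma gr_class_linear d : linear (gr_class d).
Proof.
move=> a x y; rewrite /gr_class -linearP; congr (quotm_pi _ _).
by apply: val_inj; rewrite /= !linearP.
Qed.

HB.instance Definition _ d :=
  GRing.isLinear.Build K T (gr_piece d) _ (gr_class d) (gr_class_linear d).

Lemma gr_class_finite t :
  exists m, forall d, (m <= d)%N -> gr_class d t = 0.
Proof.
exists (\max_(w <- msupp t) (fdeg w).+1) => d le_d; apply/eqP.
rewrite gr_class_eq0; suff -> : hcomp d t = 0 by rewrite raddf0 rpred0.
apply/malgP => w; rewrite hcompE mcoeff0; case: eqP => // def_d.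
case: msuppP => // wt; move: le_d; rewrite -def_d leqNgt.
by rewrite (bigD1_seq w) ?fset_uniq //= leq_max leqnn.
Qed.

(* The class of [t] in [quad_alg] goes to the family of the classes of its
   homogeneous components: see [natural_mapE], which also shows that the choice
   of the representative is immaterial. *)
Definition natural_map (a : quad_alg) : gr_deformed :=
  GrDeformed (gr_class_finite (quotm_repr a)).

Lemma gr_class_mul (a x b : T) : (forall d, gr_class d x = 0) ->
  forall d, gr_class d (a * x * b) = 0.
Proof.
move=> hx d.
have suml (r : seq {fmonom 'I_n}) (F : _ -> T) (y : T) :
  (\sum_(u <- r) F u) * y = \sum_(u <- r) F u * y by exact: mulr_suml.
have sumr (r : seq {fmonom 'I_n}) (F : _ -> T) (y : T) :
  y * (\sum_(u <- r) F u) = \sum_(u <- r) y * F u by exact: mulr_sumr.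
rewrite (monalgE a) (suml _ _ x) (suml _ _ b) raddf_sum big1 //= => u _.
rewrite (monalgE b) (sumr (msupp b)) raddf_sum big1 //= => v _.
apply/eqP; rewrite gr_class_eq0.
rewrite hcompM; case: ifP => le_d; last by rewrite raddf0 rpred0.
have /eqP := hx (d - (fdeg u + fdeg v))%N; rewrite gr_class_eq0.
move=> /asboolP[t ht /eqP]; rewrite quotm_piE => hJ.
apply/asboolP; exists (<< a@_u *g u >> * t * << b@_v *g v >>).
  exact: deg_ltM.
apply/eqP; rewrite quotm_piE -mulrBl -mulrBr.
by have [_ _] := ideal_is_ideal
  [set tensor2 (val x) - (beta x : K)%:MP | x in [set: subsp S]]; apply.
Qed.

Lemma gr_class_quad_ideal t : t \in quad_ideal -> forall d, gr_class d t = 0.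
Proof.
move=> ht; apply: (ideal_ind (P := fun t => forall d, gr_class d t = 0)) ht.
  split=> [d|x y hx hy d|a x b hx d]; [exact: raddf0| |exact: gr_class_mul].
  by rewrite raddfD /= hx hy addr0.
move=> _ [x _ <-] d; apply/eqP; rewrite gr_class_eq0 hcomp_tensor2.
case: eqP => [->|_]; last by rewrite raddf0 rpred0.
apply/asboolP; exists (beta x : K)%:MP.
  by apply/deg_ltP => w dw; rewrite mcoeffC; case: eqP dw => // ->; rewrite fdeg1.
by apply/eqP; rewrite quotm_piE; apply: ideal_gen; exists x.
Qed.

Lemma natural_mapE t d :
  gr_comp (natural_map (quotm_pi quad_ideal t)) d = gr_class d t.
Proof.
apply/eqP; rewrite /natural_map /= eq_sym -subr_eq0 -raddfB; apply/eqP.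
exact: gr_class_quad_ideal (quotm_repr_pi quad_ideal t) d.
Qed.

(* By [natural_mapE], [natural_map] is linear, and multiplicative for the products
   induced by that of [T(W)]; hence it is an isomorphism iff it is bijective. *)
Definition PBW_deformation : Prop := bijective natural_map.

End WithBeta.
End Deformation.

(** * The braidings *)

Section Braiding.
Variables (R : realType) (q : R) (N : nat).
Local Notation C := R[i].

Definition qpow (a : R) : C := (q `^ a)%:C.

Definition theta (k : int) : C := (0 < k)%R%:R.

Definition bilinear_extension (f : 'I_N -> 'I_N -> 'M[C]_N) (x : 'M[C]_N) :
  'M[C]_N := \sum_(i < N) \sum_(j < N) x i j *: f i j.

Definition braiding_V : 'M[C]_N -> 'M[C]_N :=
  bilinear_extension (fun i j =>
    qpow ((i == j)%:R - N%:R^-1) *: delta_mx j i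
    + (theta (j%:Z - i%:Z) * qpow (- N%:R^-1) * (q - q^-1)%:C) *: delta_mx i j).

Definition braiding_Vdual : 'M[C]_N -> 'M[C]_N :=
  bilinear_extension (fun i j =>
    qpow ((i == j)%:R - N%:R^-1) *: delta_mx j i
    + (theta (i%:Z - j%:Z) * qpow (- N%:R^-1) * (q - q^-1)%:C) *: delta_mx i j).

(* In [R[i]], [0 < a] means that [a] is real and positive. *)
Definition positive_eigenvector (B : 'M[C]_N -> 'M[C]_N) : set 'M[C]_N :=
  [set x | x != 0 /\ exists2 a : C, 0 < a & B x = a *: x].

(* S_q^2 W; the braided exterior algebra is [quad_alg (braided_sym2 B)]. *)
Definition braided_sym2 (B : 'M[C]_N -> 'M[C]_N) : {pred 'M[C]_N} :=
  lspan (positive_eigenvector B).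

HB.instance Definition _ B := GRing.SubmodClosed.on (braided_sym2 B).

End Braiding.

Arguments braiding_V {R} q N x.
Arguments braiding_Vdual {R} q N x.

(* Main.v *)
(* For i before j in the order of the basis, the relations of the braided exterior
   algebra are v_i v_i = 0 and v_j v_i = - q v_i v_j, so in the deformation one has
   v_i v_i = b_i and v_j v_i = b_ij - q v_i v_j.  Computing v_j v_i v_i in two ways gives
   (1 - q) b_ij v_i + (q^2 - 1) b_i v_j = 0 there, and v_j v_j v_i gives
   (1 - q) b_ij v_j + (q^2 - 1) b_j v_i = 0.  The PBW property makes the map from W to
   the deformation injective, so all b_i and b_ij vanish as q^2 <> 1. *)

Require Import Defs.
From mathcomp Require Import all_boot all_order all_algebra.
From mathcomp Require Import boolp classical_sets reals exp complex monalg ring.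

Import Order.TTheory GRing.Theory Num.Theory.
Local Open Scope ring_scope.

Lemma linear_fixed (K : pzRingType) (V : lmodType K) (f : {linear V -> V})
    (u v : V) (c d : K) :
  f u = u -> f v = v -> f (c *: u + d *: v) = c *: u + d *: v.
Proof. by move=> fu fv; rewrite linearD !linearZ /= fu fv. Qed.

Lemma scalar_comb (K : fieldType) (V : lmodType K) (f : {scalar V})
    (u v : V) (c d : K) : f (c *: u + d *: v) = c * f u + d * f v.
Proof. by rewrite linearD !linearZ. Qed.
Arguments scalar_comb {K V}.

(* Stated through a scalar form because rewriting with the module laws inside
   the concrete tensor algebra triggers expensive unfoldings. *)
Lemma overlap_cancel_scalar (K : fieldType) (V : lmodType K) (f : {scalar V})
    (x y m1 m2 m3 : V) (b c d : K) :
  f (m1 - b *: y - (c *: m2 + m1 - d *: x) + c *: (c *: m3 + m2 - d *: x)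
     - c ^+ 2 *: (m3 - b *: y))
  = f (((1 - c) * d) *: x + ((c ^+ 2 - 1) * b) *: y).
Proof. by rewrite !(linearB, linearD, linearZ) /=; ring. Qed.
Arguments overlap_cancel_scalar {K V}.

(** * Low degrees and overlap identities in the tensor algebra *)

Section TensorAlgebra.
Set Implicit Arguments.
Unset Strict Implicit.
Variables (K : fieldType) (n : nat).
Local Notation T := (tensor_alg K n).
Implicit Types (a b x y : T) (c : K).

(** A scalar is a multiple of the empty word, which commutes with every word. *)
Lemma tensor_alg_scaleAr c x y : x * (c *: y) = c *: (x * y).
Proof.
suff comm_c (z : T) : z * c%:MP = c%:MP * z by rewrite -!mul_malgC !mulrA comm_c.
rewrite (monalgE z) (mulr_suml _ _ _ c%:MP) (mulr_sumr _ _ _ c%:MP).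
apply: eq_bigr => w _.
by rewrite !malgM_def !fgmulUU mulm1 mul1m mulrC.
Qed.

Lemma tensor2_linear : linear (@tensor2 K n).
Proof.
move=> c M P; rewrite /tensor2 scaler_sumr -big_split; apply: eq_bigr => i _ /=.
rewrite scaler_sumr -big_split; apply: eq_bigr => j _ /=.
by rewrite !mxE scalerDl scalerA.
Qed.

Lemma tensor2_delta i j :
  tensor2 (delta_mx i j) = generator K i * generator K j :> T.
Proof.
rewrite /tensor2 (bigD1 i) //= [X in _ + X]big1 => [|k ne_ki].
  rewrite [LHS]addr0 (bigD1 j) //=.
  rewrite [X in _ + X]big1 => [|k ne_kj].
    by rewrite [LHS]addr0 mxE !eqxx scale1r.
  by rewrite mxE (negPf ne_kj) andbF scale0r.
by rewrite big1 // => l _; rewrite mxE (negPf ne_ki) scale0r.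
Qed.

Lemma generator_mcoeff i j :
  (generator K i : T)@_(fmu j) = (i == j)%:R.
Proof. by rewrite mcoeffU1 fmP !fmU eqseq_cons andbT. Qed.

Lemma hcomp1_generator i : hcomp 1 (generator K i) = generator K i :> T.
Proof. by rewrite hcompU fdegU. Qed.

(** The generators are homogeneous of degree 2, and multiplication never shortens words: tensors
    without terms of degree below 2 form a two-sided ideal. *)
Lemma quad_ideal_mcoeff (S : submodClosed 'M[K]_n) (t : T) w :
  t \in quad_ideal S -> (fdeg w < 2)%N -> t@_w = 0.
Proof.
move=> t_in; move: w.
apply: (ideal_ind (P := fun t : T => forall w, (fdeg w < 2)%N -> t@_w = 0)) t_in.
  split=> [w _|x y x0 y0 w lt_w|a x b x0 w lt_w].
  - by rewrite mcoeff0.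
  - by rewrite mcoeffD x0 ?y0 ?addr0.
  apply/eqP; rewrite mcoeff_eq0; apply/negP.
  case/msuppM_le => [u [v [/msuppM_le[k1 [k2 [_ + def_u]]] _ def_w]]].
  rewrite -mcoeff_neq0 x0 ?eqxx //; apply: leq_ltn_trans lt_w.
  by rewrite def_w def_u !fdegM addnAC leq_addl.
move=> _ [x _ <-] w lt_w.
have := congr1 (fun t : T => t@_w) (hcomp_tensor2 (fdeg w) (val x)).
by rewrite hcompE eqxx (ltn_eqF lt_w) mcoeff0.
Qed.

Lemma mulr_subC x y c : x * (y - c%:MP) = x * y - c *: x.
Proof.
by rewrite mulrBr -[c%:MP]mulr1 mul_malgC tensor_alg_scaleAr [x * 1]mulr1.
Qed.

Lemma mulr_subCl x y c : (y - c%:MP) * x = y * x - c *: x.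
Proof. by rewrite mulrBl mul_malgC. Qed.

(** The coefficients [1], [-1], [c], [- c ^+ 2] are those that make the cubic monomials [m1], [m2],
    [m3] cancel, so that only terms linear in [x] and [y] survive. *)
Lemma overlap_cancel (x y m1 m2 m3 t1 t2 t3 t4 : T) (b c d : K) :
    t1 = m1 - b *: y -> t2 = c *: m2 + m1 - d *: x ->
    t3 = c *: m3 + m2 - d *: x -> t4 = m3 - b *: y ->
  t1 - t2 + c *: t3 - c ^+ 2 *: t4
  = ((1 - c) * d) *: x + ((c ^+ 2 - 1) * b) *: y.
Proof.
move=> -> -> -> ->; apply/malgP => w.
exact: (overlap_cancel_scalar (mcoeff w)).
Qed.

Lemma mul_qcomm (a x y : T) c d :
  a * (c *: (x * y) + y * x - d%:MP)
  = c *: (a * x * y) + a * y * x - d *: a.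
Proof.
rewrite mulr_subC mulrDr (tensor_alg_scaleAr c a (x * y)).
exact (congr2 (fun s t => c *: s + t - d *: a) (mulrA a x y) (mulrA a y x)).
Qed.

Lemma qcomm_mul (a x y : T) c d :
  (c *: (x * y) + y * x - d%:MP) * a
  = c *: (x * y * a) + y * x * a - d *: a.
Proof. by rewrite mulr_subCl mulrDl -scalerAl. Qed.

(* The ambiguities [y x x] and [y y x] of the rewriting rules
   [x^2 -> b], [y^2 -> b], [y x -> d - c x y] are resolved in two ways. *)
Lemma overlap_yxx x y (b c d : K) :
  y * (x * x - b%:MP) - (c *: (x * y) + y * x - d%:MP) * x
  + c *: (x * (c *: (x * y) + y * x - d%:MP)) - c ^+ 2 *: ((x * x - b%:MP) * y)
  = ((1 - c) * d) *: x + ((c ^+ 2 - 1) * b) *: y.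
Proof.
apply: (@overlap_cancel x y (y * x * x) (x * y * x) (x * x * y)).
- by rewrite mulr_subC mulrA.
- exact (qcomm_mul x x y c d).
- exact (mul_qcomm x x y c d).
- exact: mulr_subCl.
Qed.

Lemma overlap_yyx x y (b c d : K) :
  (y * y - b%:MP) * x - y * (c *: (x * y) + y * x - d%:MP)
  + c *: ((c *: (x * y) + y * x - d%:MP) * y) - c ^+ 2 *: (x * (y * y - b%:MP))
  = ((1 - c) * d) *: y + ((c ^+ 2 - 1) * b) *: x.
Proof.
(* The same cancellation, with the roles of [x] and [y] exchanged. *)
apply: (@overlap_cancel y x (y * y * x) (y * x * y) (x * y * y)).
- exact: mulr_subCl.
- exact (mul_qcomm y x y c d).
- exact (qcomm_mul y x y c d).
- by rewrite mulr_subC mulrA.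
Qed.

End TensorAlgebra.

(** * Consequences of the PBW property *)

Section Deformation.
Set Implicit Arguments.
Unset Strict Implicit.
Variables (K : fieldType) (n : nat) (S : submodClosed 'M[K]_n).
Variable beta : {linear subsp S -> K^o}.
Local Notation T := (tensor_alg K n).

Lemma gr_deformed_eq (a b : gr_deformed beta) :
  (forall d, gr_comp a d = gr_comp b d) -> a = b.
Proof.
case: a b => [a fin_a] [b fin_b] /= eq_ab.
have {}eq_ab : a = b by apply: functional_extensionality_dep.
by rewrite -eq_ab in fin_b *; congr GrDeformed; apply: Prop_irrelevance.
Qed.

Hypothesis pbw : PBW_deformation beta.

(** Such a [t] has zero class in every graded piece, so injectivity of [natural_map] puts it in
    [quad_ideal S], which contains nothing nonzero of degree 1. *)
Lemma PBW_deformed_ideal_hcomp1 (t : T) :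
  t \in deformed_ideal beta -> hcomp 1 t = t -> t = 0.
Proof.
move=> t_in t1.
suff t_quad : t \in quad_ideal S.
  apply/malgP => w; rewrite mcoeff0 -t1 hcompE; case: eqP => // w1.
  by rewrite (quad_ideal_mcoeff t_quad) ?w1.
have hcomp_t d : hcomp d t = if d == 1%N then t else 0.
  apply/malgP => w; rewrite -[t in LHS]t1 !hcompE.
  case: (eqVneq d 1%N) => [->|d1]; first by rewrite -[in RHS]t1 hcompE; case: eqP.
  by rewrite mcoeff0; case: eqP => // ->; rewrite (negPf d1).
rewrite -quotm_pi_eq0 -(raddf0 (quotm_pi (quad_ideal S))).
apply/eqP/(bij_inj pbw)/gr_deformed_eq => d.
rewrite !natural_mapE raddf0; apply/eqP; rewrite gr_class_eq0 hcomp_t.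
case: eqP => _; last by rewrite raddf0 rpred0.
by move: t_in; rewrite -quotm_pi_eq0 => /eqP ->; rewrite rpred0.
Qed.

Lemma deformed_idealMl (a t : T) :
  t \in deformed_ideal beta -> a * t \in deformed_ideal beta.
Proof.
move=> t_in; have [_ _ /(_ a t 1 t_in)] := ideal_is_ideal
  [set tensor2 (val x) - (beta x : K)%:MP | x in [set: subsp S]]%classic.
by rewrite mulr1.
Qed.

Lemma deformed_idealMr (t a : T) :
  t \in deformed_ideal beta -> t * a \in deformed_ideal beta.
Proof.
move=> t_in; have [_ _ /(_ 1 t a t_in)] := ideal_is_ideal
  [set tensor2 (val x) - (beta x : K)%:MP | x in [set: subsp S]]%classic.
by rewrite mul1r.
Qed.

Lemma deformed_ideal_gen (x : subsp S) :
  tensor2 (val x) - (beta x : K)%:MP \in deformed_ideal beta.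
Proof. by apply: ideal_gen; exists x. Qed.

Lemma PBW_generators_free (i j : 'I_n) (c d : K) : i != j ->
  c *: generator K i + d *: generator K j \in deformed_ideal beta ->
  c = 0 /\ d = 0.
Proof.
move=> ne_ij t_in.
have t0 : c *: generator K i + d *: generator K j = 0 :> T.
  apply: PBW_deformed_ideal_hcomp1 => //.
  by apply: linear_fixed; apply: hcomp1_generator.
have coef0 w : c * (generator K i : T)@_w + d * (generator K j : T)@_w = 0.
  by rewrite -(scalar_comb (mcoeff w)) t0; exact: mcoeff0.
have := (coef0 (fmu i), coef0 (fmu j)).
rewrite !generator_mcoeff !eqxx [j == i]eq_sym (negPf ne_ij) !mulr0 !mulr1.
by rewrite addr0 add0r => -[].
Qed.

(** Each overlap puts a combination of two distinct generators into the deformed ideal. Its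
    coefficients vanish, and the factors [1 - c] and [c ^+ 2 - 1] can be cancelled. *)
Lemma PBW_pair_eq0 (i j : 'I_n) (c : K) (x y z : subsp S) :
    i != j -> c != 1 -> c ^+ 2 != 1 ->
    val x = delta_mx i i -> val y = delta_mx j j ->
    val z = c *: delta_mx i j + delta_mx j i ->
  [/\ beta x = 0, beta y = 0 & beta z = 0].
Proof.
move=> ne_ij c1 c2 def_x def_y def_z.
have tz : tensor2 (val z) = c *: (generator K i * generator K j)
                            + generator K j * generator K i.
  by rewrite def_z tensor2_linear !tensor2_delta.
have Jx := deformed_ideal_gen x; rewrite def_x tensor2_delta in Jx.
have Jy := deformed_ideal_gen y; rewrite def_y tensor2_delta in Jy.
have Jz := deformed_ideal_gen z; rewrite tz in Jz.
have JB (s1 s2 s3 s4 : T) (e f : K) :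
    s1 \in deformed_ideal beta -> s2 \in deformed_ideal beta ->
    s3 \in deformed_ideal beta -> s4 \in deformed_ideal beta ->
    s1 - s2 + e *: s3 - f *: s4 \in deformed_ideal beta.
  move=> J1 J2 J3 J4; rewrite -[- s2]scaleN1r -[- (f *: s4)]scaleN1r.
  by apply/rpredD/rpredZ/rpredZ => //; apply/rpredD/rpredZ => //; apply/rpredD/rpredZ.
have nz (e u : K) : e * u = 0 -> e != 0 -> u = 0.
  by move=> /eqP; rewrite mulf_eq0 => /orP[->|/eqP].
have /(PBW_generators_free ne_ij)[z0 x0] :
    ((1 - c) * (beta z : K)) *: generator K i
    + ((c ^+ 2 - 1) * (beta x : K)) *: generator K j \in deformed_ideal beta.
  rewrite -overlap_yxx; apply: JB.
  - exact (deformed_idealMl _ Jx).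
  - exact (deformed_idealMr _ Jz).
  - exact (deformed_idealMl _ Jz).
  - exact (deformed_idealMr _ Jx).
have ne_ji : j != i by rewrite eq_sym.
(* The first overlap says nothing about [beta y]; the second one settles it. *)
have /(PBW_generators_free ne_ji)[_ y0] :
    ((1 - c) * (beta z : K)) *: generator K j
    + ((c ^+ 2 - 1) * (beta y : K)) *: generator K i \in deformed_ideal beta.
  rewrite -overlap_yyx; apply: JB.
  - exact (deformed_idealMr _ Jy).
  - exact (deformed_idealMl _ Jz).
  - exact (deformed_idealMr _ Jz).
  - exact (deformed_idealMl _ Jy).
by split; [apply: nz x0 _|apply: nz y0 _|apply: nz z0 _];
  rewrite subr_eq0 // eq_sym.
Qed.

(* [e] is the strict order on the basis: [<] for V and [>] for V^*. *)
Variables (c : K) (e : rel 'I_n).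
Hypotheses (n_gt1 : (1 < n)%N) (c_neq1 : c != 1) (sqr_c_neq1 : c ^+ 2 != 1).
Hypothesis eE : forall i j, e i j = (i != j) && ~~ e j i.
Hypothesis S_diag : forall i, delta_mx i i \in S.
Hypothesis S_pair : forall i j, e i j -> c *: delta_mx i j + delta_mx j i \in S.
Hypothesis S_coef : forall (x : 'M[K]_n) i j, x \in S -> e i j ->
  x i j = c * x j i.

(** By [S_coef], every element of [S] is a combination of the matrices in [S_diag] and [S_pair], on
    which [beta] vanishes by [PBW_pair_eq0]. *)
Lemma PBW_beta_eq0 x : beta x = 0.
Proof.
(* The default [0] can occur only in [P i j] without [e i j], and the sums below avoid these. *)
pose D i : subsp S := insubd 0 (delta_mx i i).
pose P i j : subsp S := insubd 0 (c *: delta_mx i j + delta_mx j i).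
have valD i : val (D i) = delta_mx i i by rewrite insubdK ?S_diag.
have val_P i j : e i j -> val (P i j) = c *: delta_mx i j + delta_mx j i.
  by move=> eij; rewrite insubdK // S_pair.
have pair0 i j : e i j -> [/\ beta (D i) = 0, beta (D j) = 0 & beta (P i j) = 0].
  move=> eij; apply: (@PBW_pair_eq0 i j c) => //; last exact: val_P.
  by move: eij; rewrite eE => /andP[].
have D0 i : beta (D i) = 0.
  (* Since [n > 1], every index belongs to some pair. *)
  have [j ne_ij] : exists j, i != j.
    apply/existsP; apply: contraLR n_gt1; rewrite -leqNgt.
    rewrite negb_exists => /forallP eq_i.
    rewrite -[n]card_ord (eq_card1 (x := i)) // => j.
    by have /negPn/eqP -> := eq_i j; rewrite !inE eqxx.
  case eij: (e i j); first by have [] := pair0 _ _ eij.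
  have eji : e j i by rewrite eE eq_sym ne_ij eij.
  by have [] := pair0 _ _ eji.
have valQ i j : e i j -> val (val x j i *: P i j) =
    val x i j *: delta_mx i j + val x j i *: delta_mx j i.
  move=> eij; rewrite linearZ /= (val_P _ _ eij) scalerDr scalerA mulrC.
  by rewrite -(S_coef (valP x) eij).
have valDx i : val (val x i i *: D i) = val x i i *: delta_mx i i.
  by rewrite linearZ /= valD.
have sumD : val (\sum_i val x i i *: D i) = \sum_i val x i i *: delta_mx i i.
  by rewrite raddf_sum; apply: eq_bigr => i _; apply: valDx.
have sumP : val (\sum_i \sum_(j | e i j) val x j i *: P i j) =
    \sum_i \sum_(j | e i j) val x i j *: delta_mx i j
    + \sum_i \sum_(j | e i j) val x j i *: delta_mx j i.
  rewrite raddf_sum -big_split; apply: eq_bigr => i _.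
  by rewrite raddf_sum -big_split; apply: eq_bigr => j; apply: valQ.
have -> : x = \sum_i (val x i i *: D i)
            + \sum_i \sum_(j | e i j) val x j i *: P i j.
  apply: val_inj; rewrite raddfD /= sumD sumP [LHS]matrix_sum_delta.
  (* After the exchange all sums run along row [i], which splits into the diagonal entry, the [j]
     with [e i j] and the [j] with [e j i]. *)
  rewrite [X in _ = _ + (_ + X)](exchange_big_dep xpredT) //=.
  rewrite -!big_split /=; apply: eq_bigr => i _.
  rewrite (bigD1 i) //= (bigID (e i)) /=; congr (_ + (_ + _)).
    by apply: eq_bigl => j; rewrite eE eq_sym; case: (i == j).
  apply: eq_bigl => j; rewrite [e j i]eE eq_sym.
  by case: (j == i).
rewrite raddfD !raddf_sum /= big1 => [|i _]; last first.
  by rewrite linearZ /= D0 scaler0.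
rewrite add0r big1 // => i _; rewrite raddf_sum big1 //= => j eij.
by have [_ _ P0] := pair0 _ _ eij; rewrite linearZ /= P0 scaler0.
Qed.

End Deformation.

(** * Positive eigenvectors of the braidings *)

Section Braiding.
Set Implicit Arguments.
Unset Strict Implicit.
Variables (R : realType) (q : R) (N : nat).
Local Notation C := R[i].
Local Open Scope complex_scope.

Lemma bilinear_extensionE (a b : 'I_N -> 'I_N -> C) (x : 'M[C]_N) k l :
  bilinear_extension (fun i j => a i j *: delta_mx j i + b i j *: delta_mx i j)
    x k l = a l k * x l k + b k l * x k l.
Proof.
rewrite /bilinear_extension.
under eq_bigr => i _ do under eq_bigr => j _ do rewrite scalerDr !scalerA.
under eq_bigr => i _ do rewrite big_split /=.
rewrite big_split /= exchange_big /=.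
have sum_delta (f : 'I_N -> 'I_N -> C) :
    \sum_i \sum_j f i j *: delta_mx i j = \matrix_(i, j) f i j.
  rewrite [RHS]matrix_sum_delta; apply: eq_bigr => i _.
  by apply: eq_bigr => j _; rewrite mxE.
by rewrite !sum_delta !mxE mulrC [_ * b _ _]mulrC.
Qed.

Hypotheses (q_gt0 : 0 < q) (q_lt1 : q < 1).

Lemma qpowE (b : bool) :
  qpow q (b%:R - N%:R^-1) = (if b then q%:C else 1) * qpow q (- N%:R^-1).
Proof.
rewrite /qpow; case: b; rewrite ?sub0r ?mul1r //.
by rewrite powRD ?(gt_eqF q_gt0) ?implybT // powRr1 ?ltW // rmorphM.
Qed.

Lemma qpow_gt0 a : 0 < qpow q a.
Proof. by rewrite /qpow ltcR powR_gt0. Qed.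

Variables (B : 'M[C]_N -> 'M[C]_N) (e : rel 'I_N).
Hypothesis eE : forall i j, e i j = (i != j) && ~~ e j i.
Let p := qpow q (- N%:R^-1).
Let Q : C := q%:C.
(** An entrywise form common to both braidings: [p] is $q^{-1/N}$, and [e k l] stands for the value
    of [theta]. *)
Hypothesis BE : forall x k l,
  B x k l = (if k == l then Q else 1) * p * x l k
            + (e k l)%:R * p * (Q - Q^-1) * x k l.

Let p_gt0 : 0 < p. Proof. exact: qpow_gt0. Qed.
Let Q_gt0 : 0 < Q. Proof. by rewrite /Q ltcR. Qed.
Let Q_neq0 : Q != 0. Proof. by rewrite gt_eqF. Qed.
Let Q_neq1 : Q != 1. Proof. by rewrite lt_eqF // /Q ltcR. Qed.
Let sqr_Q_neq1 : Q ^+ 2 != 1.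
Proof. by rewrite lt_eqF // expr_lt1 // ?ltW // /Q ltcR. Qed.

Lemma eigenvector_braided_sym2 x : x != 0 -> B x = (Q * p) *: x ->
  x \in braided_sym2 B.
Proof.
move=> x0 Bx; apply/asboolP; apply: sub_gen_smallest.
by split=> //; exists (Q * p); rewrite // mulr_gt0.
Qed.

Lemma e_irr i : e i i = false. Proof. by rewrite eE eqxx. Qed.

Lemma braided_sym2_diag i : delta_mx i i \in braided_sym2 B.
Proof.
apply: eigenvector_braided_sym2.
  by apply/eqP => /matrixP/(_ i i); rewrite !mxE eqxx => /eqP; rewrite oner_eq0.
apply/matrixP => k l; rewrite BE !mxE.
by case: (eqVneq k i) => [->|_]; case: (eqVneq l i) => [->|_];
  rewrite ?eqxx ?e_irr /=; ring.
Qed.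

(** In the basis $v_i\otimes v_j$, $v_j\otimes v_i$, [B] is [p] times the matrix with rows
    $(Q-Q^{-1},1)$ and $(1,0)$, for which $(Q,1)$ has eigenvalue $Q$. *)
Lemma braided_sym2_pair i j : e i j ->
  Q *: delta_mx i j + delta_mx j i \in braided_sym2 B.
Proof.
move=> eij; have [ne_ij eji] : i != j /\ e j i = false.
  by move: (eij); rewrite eE => /andP[-> /negPf].
apply: eigenvector_braided_sym2.
  apply/eqP => /matrixP/(_ j i); rewrite !mxE !eqxx eq_sym (negPf ne_ij) mulr0 add0r.
  by move/eqP; rewrite oner_eq0.
have ne_ji : (j == i) = false by rewrite eq_sym (negPf ne_ij).
apply/matrixP => k l; rewrite BE !mxE.
by case: (eqVneq k i) => [->|_]; case: (eqVneq l j) => [->|_];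
  [|case: (eqVneq l i) => [->|_]|case: (eqVneq k j) => [->|_]
   |case: (eqVneq k j) => [->|_]; case: (eqVneq l i) => [->|_]];
  rewrite ?eqxx ?ne_ji ?(negPf ne_ij) ?eij ?eji /=; field.
Qed.

(* On span(v_i v_j, v_j v_i) the eigenvalues of [B] are [Q * p > 0] and
   [- p / Q < 0]; only the first one contributes. *)
Lemma braided_sym2_coef (x : 'M[C]_N) i j : x \in braided_sym2 B -> e i j ->
  x i j = Q * x j i.
Proof.
move=> /asboolP x_in eij; move: x x_in.
have [ne_ij eji] : i != j /\ e j i = false.
  by move: (eij); rewrite eE => /andP[-> /negPf].
(* The relation is linear in [x], so it suffices to check it on positive eigenvectors. *)
apply: smallest_sub; first split.
- by rewrite !mxE mulr0.
- by move=> a u v hu hv; rewrite /= !mxE hu hv; ring.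
move=> x [_ [a a_gt0 Bx]].
have := (congr1 (fun M : 'M_N => M i j) Bx, congr1 (fun M : 'M_N => M j i) Bx).
rewrite /= !BE !mxE eij eji [j == i]eq_sym (negPf ne_ij) /= => -[Eij Eji].
(* With the eigenvalue normalised by [p], the entry at [(j, i)] gives [x i j = b * x j i].
   Substituted into the entry at [(i, j)], this yields the characteristic polynomial of the
   block. *)
pose b := a / p; have b_gt0 : 0 < b by rewrite divr_gt0.
have def_a : a = b * p by rewrite divfK // gt_eqF.
have {}Eji : x i j = b * x j i.
  apply: (mulfI (lt0r_neq0 p_gt0)); move: Eji; rewrite def_a => Eji.
  by transitivity (b * p * x j i); [rewrite -Eji; ring|ring].
have : (b - Q) * (b + Q^-1) * x j i = 0.
  apply: (mulfI (lt0r_neq0 p_gt0)); rewrite mulr0.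
  move/eqP: Eij; rewrite -subr_eq0 def_a Eji => /eqP Eij.
  by rewrite -[RHS]oppr0 -Eij; field.
(* As [b] is positive, the factor [b + Q^-1] cannot vanish: either [b = Q] or both entries are
   zero. *)
move/eqP; rewrite !mulf_eq0 subr_eq0 => /orP[/orP[/eqP <- //|]|/eqP x0].
  by rewrite gt_eqF // addr_gt0 // invr_gt0.
by rewrite Eji x0 !mulr0.
Qed.

Lemma braided_exterior_PBW_eq0 (beta : {linear subsp (braided_sym2 B) -> C^o}) :
  (2 <= N)%N -> PBW_deformation beta -> forall x, beta x = 0.
Proof.
move=> N_gt1 pbw; apply: (PBW_beta_eq0 pbw N_gt1 Q_neq1 sqr_Q_neq1 eE).
- exact: braided_sym2_diag.
- exact: braided_sym2_pair.
- exact: braided_sym2_coef.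
Qed.

End Braiding.

Theorem theorem5p4 (R : realType) (N : nat) (q : R) :
  (2 <= N)%N -> 0 < q -> q < 1 ->
  (forall beta : {linear subsp (braided_sym2 (braiding_V q N)) -> R[i]^o},
     PBW_deformation beta -> forall x, beta x = 0) /\
  (forall beta : {linear subsp (braided_sym2 (braiding_Vdual q N)) -> R[i]^o},
     PBW_deformation beta -> forall x, beta x = 0).
Proof.
move=> N_gt1 q_gt0 q_lt1; split=> beta.
  (* For $V$ the factor $\theta(j-i)$ selects the natural order of the basis; for the dual,
     $\theta(i-j)$ selects the reverse order. *)
  apply: (@braided_exterior_PBW_eq0 _ _ _ q_gt0 q_lt1 _ (fun i j => (i < j)%N)) => //.
    by move=> i j; rewrite -leqNgt ltn_neqAle.
  move=> x k l; rewrite bilinear_extensionE /= (qpowE _ q_gt0) eq_sym.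
  by rewrite /theta subr_gt0 ltz_nat rmorphB /= fmorphV.
apply: (@braided_exterior_PBW_eq0 _ _ _ q_gt0 q_lt1 _ (fun i j => (j < i)%N)) => //.
  by move=> i j; rewrite -leqNgt ltn_neqAle eq_sym.
move=> x k l; rewrite bilinear_extensionE /= (qpowE _ q_gt0) eq_sym.
by rewrite /theta subr_gt0 ltz_nat rmorphB /= fmorphV.
Qed.
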